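(* Let $E$ be a sharply dominating atomic Archimedean lattice effect algebra, with compatibility center $\mathrm{B}(E)$ and center $\mathrm{C}(E)$. Then the following conditions are equivalent: (i) $\mathrm{B}(E)$ is bifull in $E$. (ii) $\mathrm{C}(E)$ is bifull in $E$.
   Context: An effect algebra is a partial algebra $(E;\oplus,0,1)$ with $0\ne 1$ and a partially defined binary operation $\oplus$ such that for all $x,y,z\in E$: (Ei) $x\oplus y=y\oplus x$ if $x\oplus y$ is defined; (Eii) $(x\oplus y)\oplus z=x\oplus(y\oplus z)$ if one side is defined; (Eiii) for every $x$ there is a unique $y$ with $x\oplus y=1$ (write $x'=y$); (Eiv) if $1\oplus x$ is defined then $x=0$. Put $x\le y$ and $y\ominus x=z$ iff $x\oplus z$ is defined and equals $y$; $\le$ is a partial order. $E$ is a lattice effect algebra if $(E,\le)$ is a lattice. For $x\in E$, $\mathrm{ord}(x)$ is the greatest positive integer $n$ for which $nx=x\oplus\cdots\oplus x$ ($n$ times) exists, and $\infty$ if all $nx$ exist; $E$ is Archimedean if $\mathrm{ord}(x)<\infty$ for all nonzero $x\in E$. An atom is a minimal nonzero element; $E$ is atomic if below every nonzero element there is an atom. Sharp elements: $\mathrm{S}(E)=\{x\in E\mid x\wedge x'=0\}$. $E$ is sharply dominating if for every $x\in E$ there is a smallest sharp element $\widehat{x}\in\mathrm{S}(E)$ with $x\le\widehat{x}$. In a lattice effect algebra, $x$ and $y$ are compatible ($x\leftrightarrow y$) if $x\vee y=x\oplus(y\ominus(x\wedge y))$. The compatibility center is $\mathrm{B}(E)=\{x\in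 E\mid x\leftrightarrow y\text{ for every }y\in E\}$. The center is $\mathrm{C}(E)=\{x\in E\mid y=(y\wedge x)\vee(y\wedge x')\text{ for all }y\in E\}$; one has $\mathrm{C}(E)=\mathrm{B}(E)\cap\mathrm{S}(E)$. Both are sub-lattice effect algebras of $E$ and carry the inherited order. For a poset $L$ and $D\subseteq L$ (with inherited order), $D$ is a $\bigvee$-bifull sub-poset of $L$ iff for every $X\subseteq D$, $\bigvee_L X$ exists iff $\bigvee_D X$ exists, in which case $\bigvee_L X=\bigvee_D X$; $\bigwedge$-bifull is defined dually; $D$ is bifull in $L$ if it is both $\bigvee$-bifull and $\bigwedge$-bifull. *)

(* Defs.v *)
From HB Require Import structures.
From mathcomp Require Import all_boot all_order.
From mathcomp Require Import boolp classical_sets.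

Set Implicit Arguments.
Unset Strict Implicit.
Unset Printing Implicit Defensive.

Import Order.TTheory.
Local Open Scope order_scope.
Local Open Scope classical_set_scope.

(* The partial operation is an option-valued function: [oplus x y = None] means
   that the sum is undefined.  Equality of options in [oplusA] thus says that if
   one side is defined then so is the other, with the same value.  The order is
   the canonical one by [le_oplus]; the factory [Choice_isEffectAlgebra] below
   shows that (Ei)-(Eiv) alone make it a partial order, so that building on
   [Order.POrder] adds no assumption. *)
HB.mixin Record isEffectAlgebra (d : Order.disp_t) E of Order.POrder d E := {
  ezero : E;
  eone : E;
  oplus : E -> E -> option E;
  ezero_neq_eone : ezero <> eone;
  oplusC : forall x y, oplus x y = oplus y x;
  oplusA : forall x y z,
    obind (fun u => oplus u z) (oplus x y) = obind (oplus x) (oplus y z);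
  orth_unique : forall x, exists! y, oplus x y = Some eone;
  eone_oplus : forall x, oplus eone x <> None -> x = ezero;
  le_oplus : forall x y : E, x <= y <-> exists z, oplus x z = Some y
}.

#[short(type="effectAlgType")]
HB.structure Definition EffectAlgebra (d : Order.disp_t) :=
  { E of Order.POrder d E & isEffectAlgebra d E }.

#[short(type="latticeEffectAlgType")]
HB.structure Definition LatticeEffectAlgebra (d : Order.disp_t) :=
  { E of EffectAlgebra d E & Order.Lattice d E }.

HB.factory Record Choice_isEffectAlgebra (d : Order.disp_t) E of Choice E := {
  ezero : E;
  eone : E;
  oplus : E -> E -> option E;
  ezero_neq_eone : ezero <> eone;
  oplusC : forall x y, oplus x y = oplus y x;
  oplusA : forall x y z,
    obind (fun u => oplus u z) (oplus x y) = obind (oplus x) (oplus y z);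
  orth_unique : forall x, exists! y, oplus x y = Some eone;
  eone_oplus : forall x, oplus eone x <> None -> x = ezero
}.

HB.builders Context (d : Order.disp_t) E of Choice_isEffectAlgebra d E.

Let leE (x y : E) : bool := `[< exists z, oplus x z = Some y >].

Let oplus1e : oplus eone ezero = Some eone.
Proof.
have [y [ey _]] := orth_unique eone.
by have y0 : y = ezero by [apply: eone_oplus; rewrite ey]; rewrite -y0.
Qed.

Let oplusx0 x : oplus x ezero = Some x.
Proof.
have [y [xy _]] := orth_unique x; have [w [_ uw]] := orth_unique y.
have := oplusA y x ezero; rewrite oplusC xy /= oplus1e.
case E0: (oplus x ezero) => [v|] //= /esym yv.
by rewrite -(uw _ yv) -(uw x) // oplusC.
Qed.

Let leE_refl : reflexive leE.
Proof. by move=> x; apply/asboolP; exists ezero. Qed.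

Let leE_anti : antisymmetric leE.
Proof.
move=> x y /andP[/asboolP[a xa] /asboolP[b yb]].
have := oplusA x a b; rewrite xa /= yb.
case ab: (oplus a b) => [c|] //= /esym xc.
have [x' [xx' _]] := orth_unique x.
have c0 : c = ezero.
  have := oplusA x' x c; rewrite oplusC xx' xc /= oplusC => E1.
  by apply: eone_oplus; rewrite oplusC E1 oplusC xx'.
have a0 : a = ezero.
  apply: eone_oplus => ea.
  by have := oplusA eone a b; rewrite ea ab /= c0 oplus1e.
by move: xa; rewrite a0 oplusx0 => -[].
Qed.

Let leE_trans : transitive leE.
Proof.
move=> y x z /asboolP[a xa] /asboolP[b yb]; apply/asboolP.
have := oplusA x a b; rewrite xa /= yb.
by case: (oplus a b) => [c|] //= /esym xc; exists c.
Qed.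

HB.instance Definition _ :=
  Order.Le_isPOrder.Build d E leE_refl leE_anti leE_trans.

Let le_oplus (x y : E) : x <= y <-> exists z, oplus x z = Some y.
Proof. by split=> /asboolP. Qed.

HB.instance Definition _ := isEffectAlgebra.Build d E
  ezero_neq_eone oplusC oplusA orth_unique eone_oplus le_oplus.

HB.end.

Definition orth (d : Order.disp_t) (E : effectAlgType d) (x : E) : E :=
  sval (cid (orth_unique x)).

(* [is_ominus y x z] reads: y (-) x is defined and equals z *)
Definition is_ominus (d : Order.disp_t) (E : effectAlgType d) (y x z : E) :=
  oplus x z = Some y.

(* n x = x (+) ... (+) x, started at 0 x = 0; [None] when it does not exist *)
Fixpoint emul (d : Order.disp_t) (E : effectAlgType d) (n : nat) (x : E) :
    option E :=
  if n is m.+1 then obind (oplus x) (emul m x) else Some ezero.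

(* ord x = n for a positive integer n; no such n exists when ord x is infinite *)
Definition is_ord (d : Order.disp_t) (E : effectAlgType d) (x : E) (n : nat) :=
  [/\ (0 < n)%N, emul n x <> None & forall m, emul m x <> None -> (m <= n)%N].

Definition archimedean (d : Order.disp_t) (E : effectAlgType d) :=
  forall x : E, x <> ezero -> exists n, is_ord x n.
Arguments archimedean {d} E.

Definition atom (d : Order.disp_t) (E : effectAlgType d) (a : E) :=
  a <> ezero /\ forall b : E, b <> ezero -> b <= a -> b = a.

Definition atomic (d : Order.disp_t) (E : effectAlgType d) :=
  forall x : E, x <> ezero -> exists2 a : E, atom a & a <= x.
Arguments atomic {d} E.

Definition sharp (d : Order.disp_t) (E : latticeEffectAlgType d) : set E :=
  [set x | (x `&` orth x)%O = ezero].

Definition sharply_dominating (d : Order.disp_t) (E : latticeEffectAlgType d) :=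
  forall x : E, exists s : E, [/\ sharp s, x <= s &
    forall t : E, sharp t -> x <= t -> s <= t].
Arguments sharply_dominating {d} E.

Definition compatible (d : Order.disp_t) (E : latticeEffectAlgType d)
    (x y : E) :=
  exists2 z : E, is_ominus y (x `&` y)%O z & oplus x z = Some (x `|` y)%O.

Definition compat_center (d : Order.disp_t) (E : latticeEffectAlgType d) :
    set E :=
  [set x | forall y, compatible x y].
Arguments compat_center {d} E.

Definition center (d : Order.disp_t) (E : latticeEffectAlgType d) : set E :=
  [set x | forall y, y = ((y `&` x) `|` (y `&` orth x))%O].
Arguments center {d} E.

(* the suprema (infima) of X computed in D with the inherited order *)
Definition supremums_in (d : Order.disp_t) (L : porderType d) (D X : set L) :
    set L :=
  (D `&` ubound X) `&` lbound (D `&` ubound X).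

Definition infimums_in (d : Order.disp_t) (L : porderType d) (D X : set L) :
    set L :=
  (D `&` lbound X) `&` ubound (D `&` lbound X).

Definition join_bifull (d : Order.disp_t) (L : porderType d) (D : set L) :=
  forall X : set L, X `<=` D ->
    (supremums X !=set0 <-> supremums_in D X !=set0) /\
    (forall s t : L, supremums X s -> supremums_in D X t -> s = t).

Definition meet_bifull (d : Order.disp_t) (L : porderType d) (D : set L) :=
  forall X : set L, X `<=` D ->
    (infimums X !=set0 <-> infimums_in D X !=set0) /\
    (forall s t : L, infimums X s -> infimums_in D X t -> s = t).

Definition bifull (d : Order.disp_t) (L : porderType d) (D : set L) :=
  join_bifull D /\ meet_bifull D.

(* Main.v *)
Require Import Defs.
From mathcomp Require Import all_boot all_order.
From mathcomp Require Import boolp classical_sets.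

Set Implicit Arguments.
Unset Strict Implicit.
Unset Printing Implicit Defensive.

Import Order.TTheory.
Local Open Scope order_scope.

(** The whole argument turns on one description of compatibility
    ([compatibleP]): x and z are compatible iff z is a sum of an element below x
    and an element below x'.  Hence compatibility with x survives orthosupplements,
    sums, differences and arbitrary existing suprema, so both centers are closed
    under orthosupplements and under suprema formed in E.  For such a subset,
    bifullness just says that suprema computed inside it are suprema in E; infima
    follow by duality ([bifullP]).

    From B(E) to C(E).  In an Archimedean atomic sharply dominating E, the sharp
    cover of v is the supremum in E of the sharp elements ord(a)a, for the atoms
    a below v ([hat_supremums]); sharp elements being principal is what makes this
    work.  If v <= y, all these elements are compatible with y, hence so is the
    sharp cover of v ([compatible_hat]).  Splitting b in B(E) along an arbitrary y
    shows that the sharp cover of b is central ([center_hat]).  Dually, the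
    largest sharp element below an upper bound in B(E) is central, so a supremum
    in C(E) is one in B(E) as well, and B(E) being bifull takes it to E.

    From C(E) to B(E).  The central elements above an atom a form an ultrafilter
    of the Boolean algebra C(E).  Its infimum in C(E) is 0 unless it has a least
    element, and 0 is not its infimum in E because a is a lower bound; so
    bifullness yields a least central element p above a ([central_cover_atom]).
    Every nonzero element of B(E) below p lies above a: otherwise it would be
    orthogonal to the sharp element ord(a)a, and so would its sharp cover, which
    being central and nonzero is p ([atom_le_compat_center]).
    Counting copies of a therefore embeds the part of B(E) below p into the finite
    chain 0, ..., ord(a), and the elements x /\ p with x in X have a greatest one
    ([compat_center_max]).  If the supremum s of X in B(E) were not below an upper
    bound u in E, choosing a below s (-) (s /\ u) and replacing the part of s below
    p by that greatest element would give a smaller upper bound in B(E). *)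

(** * Partial sums and orthosupplements *)

Section EffectAlgebraTheory.
Variables (d : Order.disp_t) (E : effectAlgType d).
Implicit Types x y z u v w : E.

Lemma oplus_sym x y z : oplus x y = Some z -> oplus y x = Some z.
Proof. by rewrite oplusC. Qed.

Lemma oplusAr x y z u w : oplus x y = Some u -> oplus u z = Some w ->
  exists2 v, oplus y z = Some v & oplus x v = Some w.
Proof.
move=> xy uz; have := oplusA x y z; rewrite xy /= uz.
by case: (oplus y z) => [v|] //= /esym xv; exists v.
Qed.

Lemma oplusAl x y z v w : oplus y z = Some v -> oplus x v = Some w ->
  exists2 u, oplus x y = Some u & oplus u z = Some w.
Proof.
move=> yz xv; have := oplusA x y z; rewrite yz /= xv.
by case: (oplus x y) => [u|] //= uz; exists u.
Qed.

Lemma oplusAC x y z u w : oplus x y = Some u -> oplus u z = Some w ->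
  exists2 v, oplus x z = Some v & oplus v y = Some w.
Proof.
move=> xy uz; have [v yz xv] := oplusAr xy uz.
exact: oplusAl (oplus_sym yz) xv.
Qed.

Lemma oplusACA x y z t u v w : oplus x y = Some u -> oplus z t = Some v ->
  oplus u v = Some w -> exists r s,
  [/\ oplus x z = Some r, oplus y t = Some s & oplus r s = Some w].
Proof.
move=> xy zt uv; have [h uz ht] := oplusAl zt uv.
have [r xz ry] := oplusAC xy uz; have [s yt rs] := oplusAr ry ht.
by exists r, s.
Qed.

Lemma oplus_orth x : oplus x (orth x) = Some (eone : E).
Proof. by rewrite /orth; case: cid => y []. Qed.

Lemma orth_eq x y : oplus x y = Some (eone : E) -> y = orth x.
Proof.
by rewrite /orth; case: cid => z /= [_ uz] xy; rewrite (uz _ xy).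
Qed.

Lemma orthK x : orth (orth x) = x.
Proof. by apply/esym/orth_eq/oplus_sym/oplus_orth. Qed.

Lemma oplus_inj x y z w : oplus x y = Some w -> oplus x z = Some w -> y = z.
Proof.
have key t : oplus x t = Some w ->
    exists2 v, oplus x (orth w) = Some v & t = orth v.
  move=> xt; have [v xw vt] := oplusAC xt (oplus_orth w).
  by exists v => //; apply: orth_eq.
by move=> /key[v xv ->] /key[v']; rewrite xv => -[->].
Qed.

Lemma oplus_lel x y z : oplus x y = Some z -> x <= z.
Proof. by move=> xy; apply/le_oplus; exists y. Qed.

Lemma oplus_ler x y z : oplus x y = Some z -> y <= z.
Proof. by move=> /oplus_sym/oplus_lel. Qed.

(** Orthogonality, as definedness of the sum, becomes an inequality; afterwards
    the order and the partial sum are interchangeable. *)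
Lemma orthogonalP x y : (exists z, oplus x y = Some z) <-> x <= orth y.
Proof.
split=> [[z xy]|/le_oplus[w xw]].
  have [v yz xv] := oplusAr xy (oplus_orth z).
  have [u xz uy] := oplusAC xy (oplus_orth z).
  by rewrite -(orth_eq (oplus_sym uy)); apply: oplus_lel xz.
have [u yx _] := oplusAl xw (oplus_orth y).
by exists u; apply: oplus_sym.
Qed.

Lemma le_orth_sym x y : x <= orth y -> y <= orth x.
Proof.
by move=> /orthogonalP[z xy]; apply/orthogonalP; exists z; apply: oplus_sym.
Qed.

Lemma le_orth x y : (orth x <= orth y) = (y <= x).
Proof.
apply/idP/idP => [/le_orth_sym|yx]; first by rewrite orthK.
by apply: le_orth_sym; rewrite orthK.
Qed.

Lemma oplusx0 x : oplus x ezero = Some x.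
Proof.
have /le_oplus[z xz] := lexx x.
have [v + vz] := oplusAC xz (oplus_orth x).
rewrite oplus_orth => -[v1]; move: vz; rewrite -v1 => z1.
by have z0 : z = ezero by [apply: eone_oplus; rewrite z1]; rewrite -z0.
Qed.

Lemma le0e x : ezero <= x.
Proof. by apply/(oplus_ler (oplusx0 x)). Qed.

Lemma lee1 x : x <= eone.
Proof. exact: oplus_lel (oplus_orth x). Qed.

Lemma lee0 x : x <= ezero -> x = ezero.
Proof. by move=> x0; apply/le_anti; rewrite x0 le0e. Qed.

Lemma oplus_le2 x y x1 y1 z1 : oplus x1 y1 = Some z1 -> x <= x1 -> y <= y1 ->
  exists2 z, oplus x y = Some z & z <= z1.
Proof.
move=> xy1 /le_oplus[a xa] /le_oplus[b yb].
by have [z [t [xy _ /oplus_lel zz1]]] := oplusACA xa yb xy1; exists z.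
Qed.

Lemma oplus_le_cancel c x y u v : oplus c x = Some u -> oplus c y = Some v ->
  u <= v -> x <= y.
Proof.
move=> cx cy /le_oplus[t ut]; have [w xt cw] := oplusAr cx ut.
by rewrite (oplus_inj cy cw); apply: oplus_lel xt.
Qed.

Lemma oplus_le_anti x y q r w : oplus x q = Some w -> oplus y r = Some w ->
  x <= y -> r <= q.
Proof.
move=> xq yr /le_oplus[t xt]; have [v tr xv] := oplusAr xt yr.
by rewrite (oplus_inj xq xv); apply: oplus_ler tr.
Qed.

Lemma emul_le a m n z : emul n a = Some z -> (m <= n)%N ->
  exists2 y, emul m a = Some y & y <= z.
Proof.
elim: n z => [|n IH] z; first by case: m => // -[<-] _; exists ezero.
case En: (emul n a) => [v|] /=; rewrite En //= => az.
rewrite leq_eqVlt ltnS => /predU1P[->|/(IH _ En)[y my yv]].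
  by exists z => //=; rewrite En.
by exists y => //; apply: le_trans yv (oplus_ler az).
Qed.

(** The interval below such an element is closed under all sums existing in E,
    hence is itself an effect algebra with the restricted sum. *)
Definition principal x :=
  forall y z u, oplus y z = Some u -> y <= x -> z <= x -> u <= x.

Lemma principal_emul x a n z : principal x -> a <= x -> emul n a = Some z ->
  z <= x.
Proof.
move=> px ax; elim: n z => [|n IH] z /=; first by move=> -[<-]; exact: le0e.
by case: (emul n a) IH => [v|] //= IH av; apply: px av ax (IH _ _).
Qed.

End EffectAlgebraTheory.

(** * Compatibility in a lattice effect algebra *)

Section Compatibility.
Variables (d : Order.disp_t) (E : latticeEffectAlgType d).
Implicit Types x y z u v w : E.

Lemma join_lub x y z : x <= z -> y <= z -> (x `|` y)%O <= z.
Proof. by move=> xz yz; rewrite leUx xz. Qed.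

Lemma meet_glb x y z : z <= x -> z <= y -> z <= (x `&` y)%O.
Proof. by move=> xz yz; rewrite lexI xz. Qed.

Lemma meet_orth x y : (orth x `&` orth y)%O = orth (x `|` y)%O.
Proof.
apply/le_anti/andP; split; last first.
  by apply: meet_glb; rewrite le_orth ?leUl ?leUr.
by apply: le_orth_sym; apply: join_lub; apply: le_orth_sym;
  rewrite ?leIl ?leIr.
Qed.

Lemma join_orth x y : (orth x `|` orth y)%O = orth (x `&` y)%O.
Proof. by rewrite -[LHS]orthK -meet_orth !orthK. Qed.

(** Adding c is an order isomorphism from the elements below c' onto those above
    c, so it commutes with meets. *)
Lemma oplus_meet c p q x y : oplus c p = Some x -> oplus c q = Some y ->
  oplus c (p `&` q)%O = Some (x `&` y)%O.
Proof.
move=> cp cq.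
have /le_oplus[r cr] : c <= (x `&` y)%O.
  by apply: meet_glb; [exact: oplus_lel cp|exact: oplus_lel cq].
suff -> : (p `&` q)%O = r by [].
have [v cv vx] := oplus_le2 cp (lexx c) (leIl p q).
have [v' + vy] := oplus_le2 cq (lexx c) (leIr q p).
rewrite cv => -[e]; rewrite -{}e in vy.
apply/le_anti/andP; split.
  by apply: oplus_le_cancel cv cr _; apply: meet_glb.
by apply: meet_glb; [apply: oplus_le_cancel cr cp _|
  apply: oplus_le_cancel cr cq _]; rewrite ?leIl ?leIr.
Qed.

(** Subtraction from w reverses the order, so it turns the join of x and y into
    the meet of their complements below w. *)
Lemma oplus_join_meet x y p q w : oplus x q = Some w -> oplus y p = Some w ->
  oplus (x `|` y)%O (p `&` q)%O = Some w.
Proof.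
move=> xq yp.
have /le_oplus[r xyr] : (x `|` y)%O <= w.
  by apply: join_lub; [exact: oplus_lel xq|exact: oplus_lel yp].
suff -> : (p `&` q)%O = r by [].
apply/le_anti/andP; split; last first.
  by apply: meet_glb; [apply: oplus_le_anti yp xyr _|
    apply: oplus_le_anti xq xyr _]; rewrite ?leUl ?leUr.
have /le_oplus[v pqv] : (p `&` q)%O <= w.
  by apply: le_trans (leIl _ _) (oplus_ler yp).
apply: oplus_le_anti xyr (oplus_sym pqv) _.
by apply: join_lub; [apply: oplus_le_anti pqv (oplus_sym xq) _|
  apply: oplus_le_anti pqv (oplus_sym yp) _]; rewrite ?leIl ?leIr.
Qed.

(** With x = a (+) p and z = a (+) b the condition on b says that a (+) p (+) b
    exists, which is Mackey compatibility.  The shared part a need not be the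
    meet: [oplus_meet] and [oplus_join_meet] show that p and b exceed the
    canonical remainders by the same element p /\ b. *)
Lemma compatibleP x z : compatible x z <->
  exists a b, [/\ a <= x, b <= orth x & oplus a b = Some z].
Proof.
split=> [[b ab xb]|[a [b [ax bx ab]]]].
  exists (x `&` z)%O, b; split=> //; first exact: leIl.
  by apply/orthogonalP; exists (x `|` z)%O; apply: oplus_sym.
have /le_oplus[p ap] := ax.
have /orthogonalP[w /oplus_sym xb] := bx.
have [v av vp] := oplusAC ap xb.
move: av; rewrite ab => -[zv]; rewrite -{}zv in vp.
have am := oplus_meet ap ab; have jm := oplus_join_meet xb vp.
have /le_oplus[e me] := leIr b p.
exists e; rewrite /is_ominus.
  have [u] := oplusAl me ab.
  by rewrite am => -[<-].
have [u xm ue] := oplusAl me xb.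
have [t xe tm] := oplusAC xm ue.
by rewrite xe (oplus_inj (oplus_sym tm) (oplus_sym jm)).
Qed.

Lemma compatible_sym x z : compatible x z -> compatible z x.
Proof.
move=> /compatibleP[a [b [ax bx ab]]]; apply/compatibleP.
have /le_oplus[p ap] := ax.
exists a, p; split=> //; first exact: oplus_lel ab.
have /orthogonalP[w /oplus_sym xb] := bx.
have [v] := oplusAC ap xb; rewrite ab => -[<-] /oplus_sym zp.
by apply/orthogonalP; exists w.
Qed.

Lemma compatible_orthl x z : compatible x z -> compatible (orth x) z.
Proof.
move=> /compatibleP[a [b [ax bx ab]]]; apply/compatibleP.
by exists b, a; rewrite orthK; split=> //; apply: oplus_sym.
Qed.

Lemma compatible_orthr x z : compatible x z -> compatible x (orth z).
Proof. by move=> /compatible_sym/compatible_orthl/compatible_sym. Qed.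

Lemma le_compatible x z : x <= z -> compatible z x.
Proof.
by move=> xz; apply/compatibleP; exists x, ezero; rewrite le0e oplusx0.
Qed.

(** The remainder of x over x /\ s is below the one over x /\ y for every y in X,
    hence below every y', hence below s'. *)
Lemma compatible_sup x (X : set E) s : (forall y, X y -> compatible x y) ->
  supremums X s -> compatible x s.
Proof.
move=> xX [sX lS]; apply/compatible_sym/compatibleP.
have /le_oplus[b ab] := leIr x s.
exists (s `&` x)%O, b; split=> //; first exact: leIl.
apply: le_orth_sym; apply: lS => y Xy.
have [c yc yc1] := compatible_sym (xX _ Xy).
apply: (@le_trans _ _ (orth c)).
  by apply/orthogonalP; exists (y `|` x)%O.
rewrite le_orth; apply: oplus_le_anti yc ab _.
by apply: meet_glb; rewrite ?leIr //; apply: le_trans (leIl _ _) (sX _ Xy).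
Qed.

Lemma supremums2 x y : supremums (fun z => z = x \/ z = y) (x `|` y)%O.
Proof.
split=> [z [->|->]|z ub]; rewrite ?leUl ?leUr //.
by apply: join_lub; apply: ub; [left|right].
Qed.

Lemma compatible_join x y z : compatible x y -> compatible x z ->
  compatible x (y `|` z)%O.
Proof.
by move=> xy xz; apply: compatible_sup (supremums2 y z) => w [->|->].
Qed.

Lemma compatible_meet x y z : compatible x y -> compatible x z ->
  compatible x (y `&` z)%O.
Proof.
move=> xy xz; rewrite -[(y `&` z)%O]orthK -join_orth.
by apply/compatible_orthr/compatible_join; apply: compatible_orthr.
Qed.

(** For y <= z both the parts below x and the remainders below x' increase, so
    subtracting them separately splits the difference along x. *)
Lemma compatible_sub x y e z : oplus y e = Some z -> compatible x y ->
  compatible x z -> compatible x e.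
Proof.
move=> ye [b1 ab1 xb1] [b2 ab2 xb2]; apply/compatibleP.
have yz : y <= z := oplus_lel ye.
have /le_oplus[f af] : (x `&` y)%O <= (x `&` z)%O.
  by apply: meet_glb; [exact: leIl|apply: le_trans (leIr _ _) yz].
have /le_oplus[g bg] : b1 <= b2.
  apply: oplus_le_cancel xb1 xb2 _.
  by apply: join_lub; [exact: leUl|apply: le_trans yz (leUr _ _)].
have [y' [e' [yy' fg yz']]] := oplusACA af bg ab2.
move: yy'; rewrite ab1 => -[yy']; rewrite -{}yy' in yz'.
rewrite -(oplus_inj ye yz') in fg.
exists f, g; split=> //; first by apply: le_trans (oplus_ler af) (leIl _ _).
apply: le_trans (oplus_ler bg) _.
by apply/orthogonalP; exists (x `|` z)%O; apply: oplus_sym.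
Qed.

(** A sum is the orthosupplement of a difference: y (+) w' = z'. *)
Lemma compatible_oplus x y z w : oplus y z = Some w -> compatible x y ->
  compatible x z -> compatible x w.
Proof.
move=> yz xy xz; rewrite -[w]orthK; apply: compatible_orthr.
have [v yv] := oplusAC yz (oplus_orth w).
move=> /orth_eq zv; have := compatible_orthr xz.
by rewrite zv orthK => xv; apply: compatible_sub yv xy xv.
Qed.

Lemma compatible_emul x a n z : emul n a = Some z -> compatible x a ->
  compatible x z.
Proof.
move=> + xa; elim: n z => [|n IH] z /=.
  by move=> -[<-]; apply: le_compatible; exact: le0e.
case: (emul n a) IH => [v|] //= IH av.
exact: compatible_oplus av xa (IH _ erefl).
Qed.

Lemma compatible_disjoint x y : compatible x y -> (x `&` y)%O = ezero ->
  oplus x y = Some (x `|` y)%O.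
Proof.
move=> [z]; rewrite /is_ominus => + + e; rewrite e.
by move=> /oplus_sym; rewrite oplusx0 => -[->].
Qed.

Lemma orthogonal_disjoint x y : x <= orth y -> (x `&` y)%O = ezero ->
  oplus x y = Some (x `|` y)%O.
Proof.
move=> xy; apply: compatible_disjoint.
by rewrite -[x]orthK; apply/compatible_orthl/le_compatible/le_orth_sym.
Qed.

(** If v is a multiple of a disjoint from x, then c = x /\ (a (+) v) satisfies
    v (+) c = v \/ c <= v (+) a; cancelling v gives c <= a, so c = 0. *)
Lemma emul_disjoint x a n z : compatible x a -> (x `&` a)%O = ezero ->
  emul n a = Some z -> (x `&` z)%O = ezero.
Proof.
move=> xa xa0; elim: n z => [|n IH] z.
  by move=> /= [<-]; apply: lee0; exact: leIr.
case En: (emul n a) => [v|] /=; rewrite En //= => av.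
have xv := IH _ En; set c := (x `&` z)%O.
have cx : c <= x by exact: leIl.
have /orthogonalP cv : c <= orth v.
  apply: le_trans cx _; apply/orthogonalP; exists (x `|` v)%O.
  by apply: compatible_disjoint xv; apply: compatible_emul En xa.
have cv0 : (c `&` v)%O = ezero.
  by apply: lee0; rewrite -xv; apply: meet_glb (leIr _ _);
    apply: le_trans (leIl _ _) cx.
have cvj := orthogonal_disjoint (proj1 (orthogonalP _ _) cv) cv0.
apply: lee0; rewrite -xa0; apply: meet_glb => //.
apply: oplus_le_cancel (oplus_sym cvj) (oplus_sym av) _.
by apply: join_lub; [exact: leIr|exact: oplus_ler av].
Qed.

End Compatibility.

(** * Sharp elements *)

Section SharpElements.
Variables (d : Order.disp_t) (E : latticeEffectAlgType d).
Implicit Types x y z u v w a t : E.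

(** For z below a sharp t, z and t' are disjoint and orthogonal, so z (+) t' is
    the join z \/ t'; it is orthogonal to every y that is orthogonal to z and
    below t. *)
Lemma sharp_principal t : sharp t -> principal t.
Proof.
move=> st y z u yz yt zt.
have zo : oplus z (orth t) = Some (z `|` orth t)%O.
  apply: orthogonal_disjoint; first by rewrite orthK.
  apply: lee0; rewrite -st; apply: meet_glb; last exact: leIr.
  exact: le_trans (leIl _ _) zt.
have /orthogonalP[w yw] : y <= orth (z `|` orth t)%O.
  by rewrite -meet_orth orthK; apply: meet_glb => //; apply/orthogonalP; exists u.
have [u' + uw] := oplusAl zo yw; rewrite yz => -[e]; rewrite -{}e in uw.
by rewrite -[t]orthK; apply/orthogonalP; exists w.
Qed.

Lemma sharp_orth x : sharp x -> sharp (orth x).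
Proof. by rewrite /sharp /= orthK meetC. Qed.

Lemma sharp0 : sharp (ezero : E).
Proof. by apply: lee0; exact: leIl. Qed.

(** An element z below both s and s' is orthogonal to and disjoint from each x in
    X, so x (+) z = x \/ z <= s.  Thus s (-) z bounds X, and z = 0. *)
Lemma sharp_sup (X : set E) s : (forall x, X x -> sharp x) ->
  supremums X s -> sharp s.
Proof.
move=> sX [uX lX]; set z := (s `&` orth s)%O.
have zs : z <= s by exact: leIl.
have /le_oplus[r zr] := zs.
suff sr : s <= r.
  have [w zs' ws] := oplus_le2 zr (lexx z) sr.
  by apply: lee0; apply: oplus_le_cancel (oplus_sym zs') (oplusx0 s) ws.
apply: lX => x Xx; have xs := uX _ Xx.
have xz : oplus x z = Some (x `|` z)%O.
  apply: orthogonal_disjoint.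
    by apply: le_trans xs _; apply: le_orth_sym; exact: leIr.
  apply: lee0; rewrite -(sX _ Xx); apply: meet_glb; first exact: leIl.
  by apply: le_trans (leIr _ _) _; apply: le_trans (leIr _ _) _; rewrite le_orth.
apply: oplus_le_cancel (oplus_sym xz) zr _.
exact: join_lub.
Qed.

Lemma sharp_join x y : sharp x -> sharp y -> sharp (x `|` y)%O.
Proof.
by move=> sx sy; apply: sharp_sup (supremums2 x y) => z [->|->].
Qed.

Lemma atom_disjoint a x : atom a -> ~ (a <= x) -> (x `&` a)%O = ezero.
Proof.
move=> [_ amin] ax; apply: contrapT => n0; apply: ax.
by rewrite -(amin _ n0 (leIr _ _)) leIl.
Qed.

Lemma atom_le_emul a n z : is_ord a n -> emul n a = Some z -> a <= z.
Proof.
by case: n => [[]//|n] _ /=; case: (emul n a) => [v|] //= /oplus_lel.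
Qed.

(** Maximality of the multiple says that a is not below z', so a is disjoint from
    z', and then so is every multiple of a. *)
Lemma sharp_emul_ord a n z : atom a -> is_ord a n -> emul n a = Some z ->
  sharp z.
Proof.
move=> aa na nz; rewrite /sharp /= meetC.
have az := atom_le_emul na nz.
apply: (emul_disjoint _ _ nz); first by apply/compatible_orthl/le_compatible.
apply: atom_disjoint => // /orthogonalP[w aw].
case: na => _ _ /(_ n.+1) /=; rewrite nz /= aw.
by move=> nn; have /nn : Some w <> None by []; rewrite ltnn.
Qed.

Lemma is_ord_emul a n : is_ord a n -> exists z, emul n a = Some z.
Proof. by case=> _; case: (emul n a) => // z _ _; exists z. Qed.

(** An atom c below the remainder of v over v /\ t lies below t too, and t is
    principal, so (v /\ t) (+) c is still below v /\ t. *)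
Lemma le_principal_of_atoms v t : atomic E -> principal t ->
  (forall a, atom a -> a <= v -> a <= t) -> v <= t.
Proof.
move=> atE pt at_; have /le_oplus[e te] := leIl v t.
have [e0|/atE[c cc ce]] := pselect (e = ezero).
  by move: te; rewrite e0 oplusx0 => -[<-]; exact: leIr.
have [w tc wv] := oplus_le2 te (lexx _) ce.
have ct : c <= t.
  by apply: at_ => //; apply: le_trans ce (oplus_ler te).
have wt : w <= (v `&` t)%O.
  by apply: meet_glb => //; apply: pt tc (leIr _ _) ct.
case: cc => -[]; apply: lee0.
exact: oplus_le_cancel tc (oplusx0 _) wt.
Qed.

End SharpElements.

(** * The two centers *)

Section Centers.
Variables (d : Order.disp_t) (E : latticeEffectAlgType d).
Implicit Types x y z u v w a b c t : E.

Lemma centerP x : center E x <-> compat_center E x /\ sharp x.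
Proof.
split=> [cx|[bx sx] y].
  split=> [y|].
    apply: compatible_sym; rewrite (cx y); apply: compatible_sym.
    apply: compatible_join; first by apply: le_compatible; exact: leIr.
    by rewrite -[x]orthK; apply: compatible_orthl; rewrite orthK;
      apply: le_compatible; exact: leIr.
  rewrite /sharp /= meetC -[x in (_ `&` x)%O]orthK meet_orth.
  (* The decomposition of 1 reads 1 = x \/ x'. *)
  have e1 z : (eone `&` z)%O = z by apply/meet_r/lee1.
  have := cx eone; rewrite !e1 => <-.
  by apply/lee0; rewrite -[ezero]orthK le_orth lee1.
have /compatibleP[a [b [ax bx' ab]]] := bx y.
apply/le_anti/andP; split; last by apply: join_lub; exact: leIl.
have : oplus a b = Some (a `|` b)%O.
  apply: orthogonal_disjoint; first by apply/orthogonalP; exists y.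
  by apply: lee0; rewrite -sx; apply: meet_glb;
    [apply: le_trans (leIl _ _) ax|apply: le_trans (leIr _ _) bx'].
rewrite ab => -[e]; rewrite {1}e; apply: leU2; apply: meet_glb => //.
  exact: oplus_lel ab.
exact: oplus_ler ab.
Qed.

Lemma compat_center_orth x : compat_center E x -> compat_center E (orth x).
Proof. by move=> bx y; apply: compatible_orthl. Qed.

Lemma compat_center_sup (X : set E) s : (forall x, X x -> compat_center E x) ->
  supremums X s -> compat_center E s.
Proof.
move=> bX Xs y; apply/compatible_sym/(compatible_sup _ Xs) => x Xx.
exact/compatible_sym/bX.
Qed.

Lemma compat_center_meet x y : compat_center E x -> compat_center E y ->
  compat_center E (x `&` y)%O.
Proof.
by move=> bx by_ z; apply/compatible_sym/compatible_meet; apply/compatible_sym.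
Qed.

Lemma compat_center_sub x y z : oplus x y = Some z -> compat_center E x ->
  compat_center E z -> compat_center E y.
Proof.
move=> xy bx bz t; apply: compatible_sym.
by apply: compatible_sub xy _ _; apply: compatible_sym.
Qed.

Lemma compat_center0 : compat_center E ezero.
Proof. by move=> y; apply/compatible_sym/le_compatible; exact: le0e. Qed.

Lemma center_orth x : center E x -> center E (orth x).
Proof.
move=> /centerP[bx sx]; apply/centerP.
by split; [apply: compat_center_orth|apply: sharp_orth].
Qed.

Lemma center_sup (X : set E) s : (forall x, X x -> center E x) ->
  supremums X s -> center E s.
Proof.
move=> cX Xs; apply/centerP; split.
  by apply: compat_center_sup Xs => x /cX/centerP[].
by apply: sharp_sup Xs => x /cX/centerP[].
Qed.

Lemma center0 : center E ezero.
Proof. by apply/centerP; split; [exact: compat_center0|exact: sharp0]. Qed.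

Lemma atom_center a c : atom a -> center E c -> a <= c \/ a <= orth c.
Proof.
move=> aa cc; have [|nac] := pselect (a <= c); [by left|right].
rewrite (cc a) [X in (X `|` _)%O]meetC (atom_disjoint aa nac).
by apply: join_lub; [exact: le0e|exact: leIr].
Qed.

(** * Bifullness of subsets closed under suprema *)

Lemma infimums_supremums_orth (X : set E) s :
  infimums X s <-> supremums (fun y => X (orth y)) (orth s).
Proof.
split=> -[lX uX]; split.
- by move=> y Xy; apply: le_orth_sym; apply: lX.
- move=> u uu; rewrite -[u]orthK le_orth; apply: uX => x Xx.
  by rewrite -[x]orthK le_orth; apply: uu; rewrite orthK.
- by move=> x Xx; rewrite -le_orth; apply: lX; rewrite orthK.
- move=> u uu; rewrite -le_orth; apply: uX => y Xy.
  by apply: le_orth_sym; apply: uu.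
Qed.

Lemma infimums_in_orth (D X : set E) s : (forall x, D x -> D (orth x)) ->
  infimums_in D X s -> supremums_in D (fun y => X (orth y)) (orth s).
Proof.
move=> oD [[Ds lX] uX]; split; first split; first exact: oD.
- by move=> y Xy; apply: le_orth_sym; apply: lX.
- move=> u [Du uu]; rewrite -[u]orthK le_orth; apply: uX; split; first exact: oD.
  by move=> x Xx; rewrite -[x]orthK le_orth; apply: uu; rewrite orthK.
Qed.

(** Suprema of E already belong to D, so only the passage from D to E carries
    information; orthosupplementation exchanges suprema and infima. *)
Lemma bifullP (D : set E) : (forall x, D x -> D (orth x)) ->
  (forall (X : set E) s, (forall x, X x -> D x) -> supremums X s -> D s) ->
  bifull D <-> (forall (X : set E) s, (forall x, X x -> D x) ->
    supremums_in D X s -> supremums X s).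
Proof.
move=> oD sD; split=> [[jD _] X s XD Xs|DE].
  have [[_ /(_ (ex_intro _ s Xs))[t Xt]] /(_ _ _ Xt Xs) <-] := jD X XD.
  exact: Xt.
split=> X XD.
  split; last by move=> s t Xs /(DE _ _ XD); exact: is_subset1_supremums.
  split=> -[s Xs]; exists s; last exact: DE.
  have Ds := sD _ _ XD Xs; case: Xs => uX lX.
  by split=> // u [_]; exact: lX.
have XD' x : X (orth x) -> D x by move=> /XD/oD; rewrite orthK.
have DI s : infimums_in D X s -> infimums X s.
  move=> Xs; apply/infimums_supremums_orth.
  exact: DE XD' (infimums_in_orth oD Xs).
split; last first.
  by move=> s t Xs /DI; exact: is_subset1_infimums.
split=> -[s Xs]; exists s; last exact: DI.
have /infimums_supremums_orth/(sD _ _ XD')/oD := Xs; rewrite orthK => Ds.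
by case: Xs => lX uX; split=> // u [_]; exact: uX.
Qed.

(** * Sharp covers of elements of the compatibility center *)

Hypothesis sdE : sharply_dominating E.
Hypothesis atE : atomic E.
Hypothesis arE : archimedean E.

Definition hat x := sval (cid (sdE x)).

Lemma sharp_hat x : sharp (hat x).
Proof. by rewrite /hat; case: cid => s []. Qed.

Lemma le_hat x : x <= hat x.
Proof. by rewrite /hat; case: cid => s []. Qed.

Lemma hat_le x t : sharp t -> x <= t -> hat x <= t.
Proof. by rewrite /hat; case: cid => s [? ? h]; exact: h. Qed.

(** The dual of the sharp cover: the largest sharp element below x. *)
Definition core x := orth (hat (orth x)).

Lemma sharp_core x : sharp (core x).
Proof. exact/sharp_orth/sharp_hat. Qed.

Lemma core_le x : core x <= x.
Proof. by rewrite -le_orth orthK; exact: le_hat. Qed.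

Lemma le_core x t : sharp t -> t <= x -> t <= core x.
Proof.
by move=> st tx; apply: le_orth_sym; apply: hat_le;
  [exact: sharp_orth|rewrite le_orth].
Qed.

(** If u bounds all ord(a)a, then these being sharp its core bounds them too, and
    a sharp element above all atoms below v is above v. *)
Lemma hat_supremums v : supremums
  (fun z => exists a n, [/\ atom a, a <= v, is_ord a n & emul n a = Some z])
  (hat v).
Proof.
split=> [z [a [n [aa av na nz]]]|u uu].
  apply: principal_emul nz; first exact/sharp_principal/sharp_hat.
  exact: le_trans av (le_hat v).
apply: le_trans (core_le u); apply: hat_le; first exact: sharp_core.
apply: le_principal_of_atoms => //; first exact/sharp_principal/sharp_core.
move=> a aa av; have [n na] := arE (proj1 aa).
have [z nz] := is_ord_emul na.
apply: le_trans (atom_le_emul na nz) _.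
apply: le_core; first exact: sharp_emul_ord nz.
by apply: uu; exists a, n.
Qed.

(** This is where the supremum must be one of E: compatibility with y passes from
    the atoms below v to their multiples, and then to suprema in E. *)
Lemma compatible_hat v y : v <= y -> compatible y (hat v).
Proof.
move=> vy; apply: compatible_sup (hat_supremums v) => z [a [n [_ av _ nz]]].
by apply: compatible_emul nz _; apply: le_compatible; apply: le_trans vy.
Qed.

(** Splitting b into v below y and w below y' makes its sharp cover the join of
    those of v and w, the first compatible with y, the second with y'. *)
Lemma center_hat b : compat_center E b -> center E (hat b).
Proof.
move=> bb; apply/centerP; split; last exact: sharp_hat.
move=> y; apply: compatible_sym.
have /compatibleP[v [w [vy wy vw]]] := compatible_sym (bb y).
have -> : hat b = (hat v `|` hat w)%O.
  apply/le_anti/andP; split; last first.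
    by apply: join_lub; apply: hat_le; try exact: sharp_hat;
      apply: le_trans (le_hat b); [exact: oplus_lel vw|exact: oplus_ler vw].
  have sj := sharp_join (sharp_hat v) (sharp_hat w).
  apply: hat_le => //; apply: sharp_principal vw _ _ => //.
    exact: le_trans (le_hat _) (leUl _ _).
  exact: le_trans (le_hat _) (leUr _ _).
apply: compatible_join; first exact: compatible_hat.
by rewrite -[y]orthK; apply/compatible_orthl/compatible_hat.
Qed.

(** * Central covers of atoms *)

Definition central_cover a p :=
  [/\ center E p, a <= p & forall c, center E c -> a <= c -> p <= c].

(** The set F of central elements above a contains c or c' for each central c.
    A central lower bound of F is thus either least in F or 0; in the second case
    0 is the infimum of F in C(E), which contradicts bifullness since a itself is
    a lower bound of F. *)
Lemma central_cover_atom a : bifull (center E) -> atom a ->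
  exists p, central_cover a p.
Proof.
move=> [_ mC] aa; apply: contrapT => nop.
pose F : set E := fun c => center E c /\ a <= c.
have F0 : infimums_in (center E) F ezero.
  split; first by split; [exact: center0|move=> c _; exact: le0e].
  move=> c [cc lc]; have [ac|ac] := atom_center aa cc.
    by case: nop; exists c; split=> // e ce ae; apply: lc.
  have /centerP[_ <-] := cc; apply: meet_glb => //.
  by apply: lc; split=> //; exact: center_orth.
have [[_ /(_ (ex_intro _ _ F0))[s Fs]] /(_ _ _ Fs F0) s0] :=
  mC F (fun c => @proj1 _ _).
case: (proj1 aa); apply: lee0; rewrite -s0.
by case: Fs => _; apply=> c [].
Qed.

(** The sharp cover of b is central and nonzero below p, so it lies above a.  If a
    were not below b, then b, being compatible with a, would be orthogonal to the
    sharp element ord(a)a, and so would its sharp cover. *)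
Lemma atom_le_compat_center a p b : atom a -> central_cover a p ->
  compat_center E b -> b <= p -> b <> ezero -> a <= b.
Proof.
move=> aa [cp ap pmin] bb bp b0; apply: contrapT => nab.
have ch := center_hat bb.
have ah : a <= hat b.
  have [//|/pmin ph] := atom_center aa ch.
  case: b0; apply: lee0; rewrite -(sharp_hat b); apply: meet_glb.
    exact: le_hat.
  exact: le_trans bp (ph (center_orth ch)).
have [n na] := arE (proj1 aa); have [z nz] := is_ord_emul na.
have sz := sharp_emul_ord aa na nz.
have bz : b <= orth z.
  apply/orthogonalP; exists (b `|` z)%O; apply: compatible_disjoint => //.
  exact: emul_disjoint (atom_disjoint aa nab) nz.
have az := le_trans ah (hat_le (sharp_orth sz) bz).
case: (proj1 aa); apply: lee0; rewrite -sz; apply: meet_glb => //.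
exact: atom_le_emul na nz.
Qed.

(** Below p, elements of B(E) are compared by the number of copies of a that they
    contain, so an x maximizing this number gives the greatest x /\ p. *)
Lemma compat_center_max a p (X : set E) : atom a -> central_cover a p ->
  (forall x, X x -> compat_center E x) -> (X !=set0)%classic ->
  exists2 x, X x & forall y, X y -> (y `&` p)%O <= (x `&` p)%O.
Proof.
move=> aa pa XB [x0 Xx0].
have [n na] := arE (proj1 aa).
have /centerP[bp _] : center E p by case: pa.
pose P k := `[< exists2 x, X x & exists2 z, emul k a = Some z & z <= x >].
have P0 : exists k, P k.
  by exists 0%N; apply/asboolP; exists x0 => //; exists ezero => //; exact: le0e.
have Pn k : P k -> (k <= n)%N.
  by move=> /asboolP[x _ [z kz _]]; case: na => _ _; apply; rewrite kz.
case: (ex_maxnP P0 Pn) => k /asboolP[x Xx [z kz zx]] kmax.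
exists x => // y Xy; have yp : (y `&` p)%O <= p by exact: leIr.
have byp : compat_center E (y `&` p)%O by apply: compat_center_meet => //; exact: XB.
have bxp : compat_center E (x `&` p)%O by apply: compat_center_meet => //; exact: XB.
have /le_oplus[e me] := leIl (y `&` p)%O (x `&` p)%O.
have be : compat_center E e.
  by apply: compat_center_sub me _ _ => //; exact: compat_center_meet.
have [e0|e0] := pselect (e = ezero).
  by move: me; rewrite e0 oplusx0 => -[<-]; exact: leIr.
have ae : a <= e.
  apply: atom_le_compat_center pa be _ e0 => //.
  exact: le_trans (oplus_ler me) yp.
(* Each multiple of a below y is below x by the choice of x, so the remainder e
   leaves room for one more copy: all multiples of a would exist. *)
have all j : exists2 w, emul j a = Some w & w <= (y `&` p)%O.
  elim: j => [|j [w jw wy]]; first by exists ezero => //; exact: le0e.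
  have wx : w <= x.
    have /(emul_le kz)[w'] : (j <= k)%N.
      apply: kmax; apply/asboolP; exists y => //; exists w => //.
      exact: le_trans wy (leIl _ _).
    by rewrite jw => -[<-] wz; apply: le_trans zx.
  have wm : w <= ((y `&` p) `&` (x `&` p))%O.
    by apply: meet_glb => //; apply: meet_glb => //; apply: le_trans yp.
  have [w' aw wy'] := oplus_le2 me wm ae.
  by exists w' => //=; rewrite jw /=; exact: oplus_sym.
case: na => _ _ /(_ n.+1); have [w -> _] := all n.+1.
by move=> nn; have /nn : Some w <> None by []; rewrite ltnn.
Qed.

(** * The two implications *)

Lemma bifull_center_of_compat_center : bifull (compat_center E) ->
  bifull (center E).
Proof.
move=> /(bifullP compat_center_orth compat_center_sup) bE.
apply/(bifullP center_orth center_sup) => X s XC [[cs us] ls].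
apply: bE => [x /XC/centerP[]//|].
split; first by split=> //; case/centerP: cs.
move=> u [bu uu]; apply: le_trans (core_le u); apply: ls; split.
  exact/center_orth/center_hat/compat_center_orth.
move=> x Xx; apply: le_core; last exact: uu.
by case/centerP: (XC _ Xx).
Qed.

Lemma bifull_compat_center_of_center : bifull (center E) ->
  bifull (compat_center E).
Proof.
move=> cE; apply/(bifullP compat_center_orth compat_center_sup).
move=> X s XB [[bs us] ls]; split=> // u uu.
have [X0|X0] := pselect (X !=set0)%classic; last first.
  apply: (@le_trans _ _ ezero); last exact: le0e.
  by apply: ls; split; [exact: compat_center0|move=> x Xx; case: X0; exists x].
have us' : forall x, X x -> x <= (s `&` u)%O.
  by move=> x Xx; apply: meet_glb; [exact: us|exact: uu].
have /le_oplus[e me] := leIl s u.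
have [e0|/atE[a aa ae]] := pselect (e = ezero).
  by move: me; rewrite e0 oplusx0 => -[<-]; exact: leIr.
have [p pa] := central_cover_atom cE aa; have [cp ap _] := pa.
have /centerP[bp sp] := cp.
have [x Xx xmax] := compat_center_max aa pa XB X0.
have /le_oplus[f xf] : (x `&` p)%O <= (s `&` p)%O by apply: leI2 => //; exact: us.
have fp : f <= p by apply: le_trans (oplus_ler xf) (leIr _ _).
have fs : f <= s by apply: le_trans (oplus_ler xf) (leIl _ _).
have bf : compat_center E f.
  by apply: compat_center_sub xf _ _; apply: compat_center_meet => //; exact: XB.
(* The smaller bound: t is s with its part below p cut down to x /\ p. *)
have /le_oplus[t ft] := fs.
have st : s <= t.
  apply: ls; split; first exact: compat_center_sub ft _ _.
  move=> y Xy; rewrite (cp y); apply: join_lub.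
    apply: le_trans (xmax _ Xy) _.
    by apply: oplus_le_cancel (oplus_sym xf) ft _; exact: leIl.
  have fy : oplus f (y `&` orth p)%O = Some (f `|` (y `&` orth p))%O.
    apply: orthogonal_disjoint.
      by apply: le_trans fp _; apply: le_orth_sym; exact: leIr.
    apply: lee0; rewrite -sp; apply: meet_glb; first exact: le_trans (leIl _ _) fp.
    by apply: le_trans (leIr _ _) (leIr _ _).
  apply: oplus_le_cancel fy ft _; apply: join_lub => //.
  exact: le_trans (leIl _ _) (us _ Xy).
have f0 : f = ezero.
  by apply: lee0; apply: oplus_le_anti (oplusx0 s) (oplus_sym ft) st.
have spx : (s `&` p)%O = (x `&` p)%O by move: xf; rewrite f0 oplusx0 => -[].
(* Now s /\ p = x /\ p is below u, which leaves no room for a. *)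
set m := ((s `&` u) `&` p)%O.
have [w mw ws] := oplus_le2 me (leIl _ p) ae.
case: (proj1 aa); apply: lee0; apply: (oplus_le_cancel mw (oplusx0 m)).
have wp : w <= p.
  by apply: sharp_principal mw _ ap => //; exact: leIr.
apply: meet_glb => //; apply: le_trans (us' _ Xx).
by apply: le_trans (leIl _ p); rewrite -spx; exact: meet_glb.
Qed.

End Centers.

Theorem theorem2p18 (d : Order.disp_t) (E : latticeEffectAlgType d) :
  sharply_dominating E -> atomic E -> archimedean E ->
  (bifull (compat_center E) <-> bifull (center E)).
Proof.
move=> sdE atE arE; split; first exact: bifull_center_of_compat_center.
exact: bifull_compat_center_of_center.
Qed.
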